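(* Let $O$ be the origin of $\mathbb{R}^2$ and let $(x(t),y(t))$, $t_0\le t\le t_1$, be a simple curve of class $C^2$ in $\mathbb{R}^2$ not passing through $O$. Suppose that $P=P(t)$ is a moving point in $\mathbb{R}^2$ (with $\overrightarrow{OP}(t)\neq\vec 0$) satisfying, for $t_0\le t\le t_1$, the following conditions: 1) for $\mathcal{D}=|\overrightarrow{OP}|$, $$\frac{d^2\mathcal{D}}{dt^2}=\frac{-(x(t)x'(t)+y(t)y'(t))^2+(x^2(t)+y^2(t))\,(x'^2(t)+x(t)x''(t)+y'^2(t)+y(t)y''(t))}{(x^2(t)+y^2(t))^{3/2}},$$ $$\frac{d\mathcal{D}}{dt}\Big|_{t=t_0}=\frac{x(t_0)x'(t_0)+y(t_0)y'(t_0)}{\sqrt{x^2(t_0)+y^2(t_0)}},\qquad \mathcal{D}|_{t=t_0}=\sqrt{x^2(t_0)+y^2(t_0)};$$ 2) $$\frac{d\vec e_{\overrightarrow{OP}}}{dt}=\frac{(x(t)y'(t)-x'(t)y(t))\,(-y(t),x(t))}{(x^2(t)+y^2(t))^{3/2}},\qquad \vec e_{\overrightarrow{OP}}|_{t=t_0}=\frac{(x(t_0),y(t_0))}{\sqrt{x^2(t_0)+y^2(t_0)}}.$$ Then the trajectory of $P$ is $\vec r(t)=(x(t),y(t))$, $t_0\le t\le t_1$; that is, $\overrightarrow{OP}(t)=(x(t),y(t))$ for all $t\in[t_0,t_1]$.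
   Context: $\vec e_{\vec w}=\vec w/|\vec w|$ denotes the unit vector in the direction of a nonzero vector $\vec w$. *)

(* Defs.v *)
From Stdlib Require Import Reals.
From Coquelicot Require Import Coquelicot.
Open Scope R_scope.

Definition vec : NormedModule R_AbsRing :=
  prod_NormedModule R_AbsRing R_NormedModule R_NormedModule.

(* Coquelicot's norm on a product is the Euclidean combination of the norms. *)
Lemma vec_normE (w : vec) : norm w = sqrt (fst w ^ 2 + snd w ^ 2).
Proof.
change (sqrt (Rabs (fst w) ^ 2 + Rabs (snd w) ^ 2) = sqrt (fst w ^ 2 + snd w ^ 2)).
now rewrite !pow2_abs.
Qed.

Definition unit_vec (w : vec) : vec := scal (/ norm w) w.

Definition itv (a b t : R) : Prop := a <= t <= b.

(* The derivative of f at t relative to the domain D: this is Coquelicot's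
   is_derive with the neighbourhoods of t restricted to D, hence a one-sided
   derivative at an endpoint of an interval, and it ignores f outside D. *)
Definition is_derive_within {V : NormedModule R_AbsRing}
    (D : R -> Prop) (f : R -> V) (t : R) (l : V) : Prop :=
  filterdiff f (within D (locally t)) (fun h : R => scal h l).

Definition is_derive_on {V : NormedModule R_AbsRing}
    (D : R -> Prop) (f f' : R -> V) : Prop :=
  forall t, D t -> is_derive_within D f t (f' t).

(* f is of class C^2 on D, with derivatives f' and f''. *)
Definition is_C2_on (D : R -> Prop) (f f' f'' : R -> R) : Prop :=
  is_derive_on D f f' /\ is_derive_on D f' f'' /\ continuous_on D f''.

(* Injective, except that the endpoints may coincide (simple closed curve). *)
Definition simple_curve (a b : R) (c : R -> vec) : Prop :=
  forall s t, itv a b s -> itv a b t -> s < t -> c s = c t -> s = a /\ t = b.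

(* Main.v *)
(* The right-hand sides are exactly the derivatives of r = |(x,y)| (second order)
   and of (x,y)/r, so D'' = r'' and the initial data give D = r, and the unit vector
   of OP equals (x,y)/r; multiplying the two gives OP = (x,y). *)
Require Import Defs.
From Stdlib Require Import Reals.
From Coquelicot Require Import Coquelicot.
From Stdlib Require Import Lra.
Open Scope R_scope.

Lemma is_derive_on_ext_total (a b : R) (f f' : R -> R) :
  a < b -> is_derive_on (itv a b) f f' ->
  exists g, forall t, itv a b t -> g t = f t /\ is_derive g t (f' t).
Proof.
intros hab hf.
(* Tangent-line extension, so that the one-sided derivatives become two-sided. *)
set (c := fun s => Rmax a (Rmin s b)).
assert (c_id : forall s, itv a b s -> c s = s).
{ intros s [h1 h2]; unfold c; rewrite Rmin_left, Rmax_right; lra. }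
assert (c_lo : forall s, s < a -> c s = a).
{ intros s h; unfold c; rewrite Rmin_left, Rmax_left; lra. }
assert (c_hi : forall s, b < s -> c s = b).
{ intros s h; unfold c; rewrite Rmin_right, Rmax_right; lra. }
exists (fun s => f (c s) + (s - c s) * f' (c s)).
intros t ht; split.
{ rewrite c_id by easy; ring. }
split; [apply is_linear_scal_l|].
intros t' ht' eps.
rewrite <- (is_filter_lim_locally_unique (V := R_NormedModule) t t' ht').
destruct (hf t ht) as [_ hd].
assert (hlim : is_filter_lim (within (itv a b) (locally t)) t).
{ intros Q hQ; unfold within.
  apply filter_imp with (2 := hQ); auto. }
specialize (hd t hlim eps); unfold within in hd.
(* Points close to [t] can leave the interval only through an endpoint that is [t] itself. *)
assert (hlo : locally t (fun s => s < a -> t = a)).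
{ destruct (Req_dec t a) as [->|hne]; [now apply filter_forall|].
  apply filter_imp with (fun s => a < s); [intros; lra|].
  apply open_gt; unfold itv in ht; lra. }
assert (hhi : locally t (fun s => b < s -> t = b)).
{ destruct (Req_dec t b) as [->|hne]; [now apply filter_forall|].
  apply filter_imp with (fun s => s < b); [intros; lra|].
  apply open_lt; unfold itv in ht; lra. }
generalize (filter_and _ _ hd (filter_and _ _ hlo hhi)).
apply filter_imp; intros s [hs [hsa hsb]].
rewrite (c_id t ht).
(* Outside the interval the extension is affine with slope [f' t], so the first-order remainder is
   exactly zero; inside, the remainder is that of [f], already bounded by [hs]. *)
destruct (Rlt_dec s a) as [h|h]; [|destruct (Rlt_dec b s) as [h'|h']].
- rewrite (c_lo s h), (hsa h).
  match goal with |- norm ?u <= _ => replace u with (zero : R_NormedModule) end.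
  { rewrite norm_zero; apply Rmult_le_pos; [apply Rlt_le, cond_pos|apply norm_ge_0]. }
  unfold minus, plus, opp, scal, zero; simpl; unfold mult; simpl; ring.
- rewrite (c_hi s h'), (hsb h').
  match goal with |- norm ?u <= _ => replace u with (zero : R_NormedModule) end.
  { rewrite norm_zero; apply Rmult_le_pos; [apply Rlt_le, cond_pos|apply norm_ge_0]. }
  unfold minus, plus, opp, scal, zero; simpl; unfold mult; simpl; ring.
- assert (his : itv a b s) by (split; lra).
  rewrite (c_id s his).
  replace (f s + (s - s) * f' s) with (f s) by ring.
  replace (f t + (t - t) * f' t) with (f t) by ring.
  exact (hs his).
Qed.

(** The difference of [g] and a total extension of [f] has zero derivative on the interval, so the
    mean value theorem makes it constant. The form is asymmetric on purpose: [f] is a given quantity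
    known only on the interval, [g] an explicit formula with two-sided derivatives. *)
Lemma is_derive_on_unique (a b : R) (f g f' : R -> R) :
  a < b -> is_derive_on (itv a b) f f' ->
  (forall t, itv a b t -> is_derive g t (f' t)) -> f a = g a ->
  forall t, itv a b t -> f t = g t.
Proof.
intros hab hf hg h0 t [hta htb].
destruct (is_derive_on_ext_total a b f f' hab hf) as [F hF].
assert (hd : forall s, itv a b s -> is_derive (fun s => F s - g s) s 0).
{ intros s hs.
  replace 0 with (minus (f' s) (f' s) : R) by exact (minus_eq_zero (f' s)).
  apply (is_derive_minus F g); [apply hF|apply hg]; easy. }
destruct (MVT_gen (fun s => F s - g s) a t (fun _ => 0)) as [c [_ hc]].
- rewrite Rmin_left, Rmax_right by lra.
  intros s hs; apply hd; split; lra.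
- rewrite Rmin_left, Rmax_right by lra.
  intros s hs; apply derivable_continuous_pt.
  exists 0; apply is_derive_Reals, hd; split; lra.
- rewrite (proj1 (hF t (conj hta htb))), (proj1 (hF a ltac:(split; lra))) in hc.
  lra.
Qed.

(** A bounded linear map is its own differential, so the chain rule applies. Taking [L] to be a
    projection splits the equation for the unit vector into scalar ones. *)
Lemma is_derive_within_linear {V W : NormedModule R_AbsRing} (D : R -> Prop)
    (L : V -> W) (f : R -> V) (t : R) (l : V) :
  is_linear L -> is_derive_within D f t l ->
  is_derive_within D (fun s => L (f s)) t (L l).
Proof.
intros hL hf; unfold is_derive_within.
apply filterdiff_ext_lin with (fun h : R => L (scal h l)).
- apply (filterdiff_comp f L _ L hf (filterdiff_linear L hL)).
- intro h; apply (linear_scal L hL).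
Qed.

(** Turns the real exponent of the hypotheses into an integer power of the radius, which [field] can
    handle. *)
Lemma Rpower_3_2 (u : R) : 0 < u -> Rpower u (3 / 2) = sqrt u ^ 3.
Proof.
intro hu.
replace (3 / 2) with (/ 2 * INR 3) by (simpl; field).
rewrite <- Rpower_mult, Rpower_sqrt by easy.
apply Rpower_pow, sqrt_lt_R0, hu.
Qed.

Lemma sum_sqr_pos (u v : R) : (u, v) <> (0, 0) -> 0 < u ^ 2 + v ^ 2.
Proof.
intro h.
destruct (Req_dec u 0) as [->|hu]; [|nra].
destruct (Req_dec v 0) as [->|hv]; [easy|nra].
Qed.

Theorem theorem2p3
  (t0 t1 : R) (ht : t0 < t1)
  (x x' x'' y y' y'' : R -> R)
  (hx : is_C2_on (itv t0 t1) x x' x'')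
  (hy : is_C2_on (itv t0 t1) y y' y'')
  (hsimple : simple_curve t0 t1 (fun t => (x t, y t)))
  (hO : forall t, itv t0 t1 t -> (x t, y t) <> (0, 0))
  (P : R -> vec)
  (hP : forall t, itv t0 t1 t -> P t <> (0, 0))
  (dist' dist'' : R -> R)
  (hdist' : is_derive_on (itv t0 t1) (fun t => norm (P t)) dist')
  (hdist'' : is_derive_on (itv t0 t1) dist' dist'')
  (h1 : forall t, itv t0 t1 t ->
     dist'' t =
       (- (x t * x' t + y t * y' t) ^ 2
        + (x t ^ 2 + y t ^ 2)
          * (x' t ^ 2 + x t * x'' t + y' t ^ 2 + y t * y'' t))
       / Rpower (x t ^ 2 + y t ^ 2) (3 / 2))
  (h1' : dist' t0 = (x t0 * x' t0 + y t0 * y' t0) / sqrt (x t0 ^ 2 + y t0 ^ 2))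
  (h1'' : norm (P t0) = sqrt (x t0 ^ 2 + y t0 ^ 2))
  (h2 : is_derive_on (itv t0 t1) (fun t => unit_vec (P t))
     (fun t => scal ((x t * y' t - x' t * y t)
                     / Rpower (x t ^ 2 + y t ^ 2) (3 / 2))
                    ((- y t, x t) : vec)))
  (h2' : unit_vec (P t0) =
     scal (/ sqrt (x t0 ^ 2 + y t0 ^ 2)) ((x t0, y t0) : vec)) :
  forall t, itv t0 t1 t -> P t = (x t, y t).
Proof.
destruct hx as [hx1 [hx2 _]]; destruct hy as [hy1 [hy2 _]].
destruct (is_derive_on_ext_total _ _ _ _ ht hx1) as [X hX].
destruct (is_derive_on_ext_total _ _ _ _ ht hx2) as [X1 hX1].
destruct (is_derive_on_ext_total _ _ _ _ ht hy1) as [Y hY].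
destruct (is_derive_on_ext_total _ _ _ _ ht hy2) as [Y1 hY1].
assert (hr : forall t, itv t0 t1 t -> 0 < x t ^ 2 + y t ^ 2).
{ intros t hs; apply sum_sqr_pos, hO, hs. }
assert (hi0 : itv t0 t1 t0) by (split; lra).
(* Building the radius from the extensions [X], [Y] gives it two-sided derivatives at [t0] and [t1]
   as well. *)
set (r := fun t => sqrt (X t ^ 2 + Y t ^ 2)).
assert (r_sqr : forall t, itv t0 t1 t -> x t ^ 2 + y t ^ 2 = r t ^ 2 /\ 0 < r t).
{ intros t hs; unfold r.
  rewrite (proj1 (hX t hs)), (proj1 (hY t hs)); split.
  - now rewrite pow2_sqrt; [|apply Rlt_le, hr].
  - apply sqrt_lt_R0, hr, hs. }
assert (sqrt_r : forall t, itv t0 t1 t -> sqrt (x t ^ 2 + y t ^ 2) = r t).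
{ intros t hs; unfold r; now rewrite (proj1 (hX t hs)), (proj1 (hY t hs)). }
assert (pow_r : forall t, itv t0 t1 t -> Rpower (x t ^ 2 + y t ^ 2) (3 / 2) = r t ^ 3).
{ intros t hs; rewrite Rpower_3_2 by (apply hr, hs); now rewrite sqrt_r. }
assert (dr : forall t, itv t0 t1 t ->
  is_derive r t ((x t * x' t + y t * y' t) / r t)).
{ intros t hs.
  destruct (hX t hs) as [eX dX], (hY t hs) as [eY dY], (r_sqr t hs) as [_ rp].
  assert (hp : 0 < X t ^ 2 + Y t ^ 2) by (rewrite eX, eY; apply hr, hs).
  apply (is_derive_ext (fun t => sqrt (X t ^ 2 + Y t ^ 2))); [easy|].
  (* This is the shape in which the chain rule for [sqrt] delivers the derivative. *)
  replace ((x t * x' t + y t * y' t) / r t)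
    with ((2 * X t * x' t + 2 * Y t * y' t) / (2 * sqrt (X t ^ 2 + Y t ^ 2)))
    by (fold (r t); rewrite eX, eY; field; lra).
  apply (is_derive_sqrt (fun t => X t ^ 2 + Y t ^ 2)); [|easy].
  auto_derive; [split; [now exists (x' t)|split; [now exists (y' t)|easy]]|].
  rewrite (is_derive_unique (fun s : R => X s) _ _ dX),
    (is_derive_unique (fun s : R => Y s) _ _ dY); ring. }
(* First integration of the distance equation. The candidate is the derivative of [r], written with
   [X1], [Y1] so that it can be differentiated once more. *)
assert (hD' : forall t, itv t0 t1 t -> dist' t = (X t * X1 t + Y t * Y1 t) / r t).
{ apply (is_derive_on_unique _ _ _ _ dist'' ht hdist'').
  - intros t hs.
    destruct (hX t hs) as [eX dX], (hY t hs) as [eY dY], (r_sqr t hs) as [r2 rp].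
    destruct (hX1 t hs) as [eX1 dX1], (hY1 t hs) as [eY1 dY1].
    specialize (dr t hs).
    auto_derive.
    { repeat split; try (eexists; eassumption); lra. }
    rewrite (is_derive_unique (fun s : R => X s) _ _ dX),
      (is_derive_unique (fun s : R => Y s) _ _ dY),
      (is_derive_unique (fun s : R => X1 s) _ _ dX1),
      (is_derive_unique (fun s : R => Y1 s) _ _ dY1),
      (is_derive_unique (fun s : R => r s) _ _ dr), (h1 t hs), (pow_r t hs), r2, eX, eY, eX1, eY1.
    (* With [r' = (x x' + y y') / r], the quotient rule gives [((x x' + y y')' r^2 - (x x' + y
       y')^2) / r^3], which is the prescribed second derivative. *)
    field; lra.
  - rewrite h1', (sqrt_r t0 hi0), (proj1 (hX t0 hi0)), (proj1 (hY t0 hi0)),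
      (proj1 (hX1 t0 hi0)), (proj1 (hY1 t0 hi0)); easy. }
assert (hD : forall t, itv t0 t1 t -> norm (P t) = r t).
{ apply (is_derive_on_unique _ _ _ _ dist' ht hdist').
  - intros t hs.
    rewrite (hD' t hs), (proj1 (hX t hs)), (proj1 (hY t hs)),
      (proj1 (hX1 t hs)), (proj1 (hY1 t hs)).
    now apply dr.
  - now rewrite h1'', sqrt_r. }
assert (hE1 : forall t, itv t0 t1 t -> fst (unit_vec (P t)) = X t / r t).
{ apply (is_derive_on_unique _ _ _ _ _ ht
    (fun t hs => is_derive_within_linear _ _ _ _ _ is_linear_fst (h2 t hs))).
  - intros t hs.
    destruct (hX t hs) as [eX dX], (r_sqr t hs) as [r2 rp].
    specialize (dr t hs).
    auto_derive.
    { repeat split; try (eexists; eassumption); lra. }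
    rewrite (is_derive_unique (fun s : R => X s) _ _ dX),
      (is_derive_unique (fun s : R => r s) _ _ dr), (pow_r t hs), eX.
    unfold scal; simpl; unfold scal; simpl; unfold mult; simpl.
    (* Without denominators the claim is [x' r^2 - x (x x' + y y') = -y (x y' - x' y)], true once
       [r^2] is expanded as [x^2 + y^2]. *)
    apply (Rmult_eq_reg_r (r t ^ 3)); [|apply pow_nonzero; lra].
    field_simplify; try lra.
    rewrite <- r2; ring.
  - rewrite h2', (sqrt_r t0 hi0), (proj1 (hX t0 hi0)).
    apply Rmult_comm. }
assert (hE2 : forall t, itv t0 t1 t -> snd (unit_vec (P t)) = Y t / r t).
{ apply (is_derive_on_unique _ _ _ _ _ ht
    (fun t hs => is_derive_within_linear _ _ _ _ _ is_linear_snd (h2 t hs))).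
  - intros t hs.
    destruct (hY t hs) as [eY dY], (r_sqr t hs) as [r2 rp].
    specialize (dr t hs).
    auto_derive.
    { repeat split; try (eexists; eassumption); lra. }
    rewrite (is_derive_unique (fun s : R => Y s) _ _ dY),
      (is_derive_unique (fun s : R => r s) _ _ dr), (pow_r t hs), eY.
    unfold scal; simpl; unfold scal; simpl; unfold mult; simpl.
    (* Likewise [y' r^2 - y (x x' + y y') = x (x y' - x' y)]. *)
    apply (Rmult_eq_reg_r (r t ^ 3)); [|apply pow_nonzero; lra].
    field_simplify; try lra.
    rewrite <- r2; ring.
  - rewrite h2', (sqrt_r t0 hi0), (proj1 (hY t0 hi0)).
    apply Rmult_comm. }
intros t hs.
destruct (r_sqr t hs) as [_ rp].
specialize (hE1 t hs); specialize (hE2 t hs).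
(* Since the norm of [P t] is [r t], both sides of each coordinate equation carry the same nonzero
   factor [/ r t], which cancels. *)
unfold unit_vec in hE1, hE2; rewrite (hD t hs) in hE1, hE2.
rewrite (proj1 (hX t hs)) in hE1; rewrite (proj1 (hY t hs)) in hE2.
destruct (P t) as [p q]; simpl in hE1, hE2.
unfold scal in hE1, hE2; simpl in hE1, hE2; unfold mult in hE1, hE2; simpl in hE1, hE2.
f_equal; apply (Rmult_eq_reg_l (/ r t)); try (apply Rinv_neq_0_compat; lra);
  [rewrite hE1|rewrite hE2]; apply Rmult_comm.
Qed.
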